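(* Let $K$ be an algebraically closed field with $\operatorname{char} K = p > 0$, let $n \ge 2$, and let $G$ be a (Zariski closed) subgroup of $\mathrm{GL}_n(K)$ such that: (a) if $p=2$: the matrix $\begin{pmatrix} a & a+1 & \\ a+1 & a & \\ & & I_{n-2}\end{pmatrix}$ (block diagonal, blank entries zero) lies in $G$ for at least three different values of $a \in K$ ($a=1$ is always one such value); (b) if $p \ge 3$: the matrix $\begin{pmatrix} 1 & 1 & \\ 0 & 1 & \\ & & I_{n-2}\end{pmatrix}$ (block diagonal, blank entries zero) lies in $G$. Let $V$ be the space of all homogeneous polynomials of degree $p$ in the variables $x_1,\dots,x_n$ over $K$, with the canonical $G$-action given by $(a_{ij})\cdot x_j = \sum_{i=1}^n a_{ij} x_i$ for $(a_{ij}) \in G$ (extended to polynomials by $K$-algebra automorphisms), so that $V$ is a $G$-module. Let $W := \langle x_1^p,\dots,x_n^p\rangle_K \le V$, which is a $G$-submodule of $V$, and let $U := \{ f \in \mathrm{Hom}_K(V,W) : f|_W = 0\}$, which is a $G$-module. Let $\iota \in \mathrm{Hom}_K(V,W)$ be given by $\iota|_W = \mathrm{id}_W$ and $\iota(m) = 0$ for every monomial $m$ of degree $p$ not lying in $W$. Let $\tilde U := U \oplus K\iota \subseteq \mathrm{Hom}_K(V,W)$ and let $\pi : \tilde U \to K$ be given by $\pi(u + \lambda\cdot\iota) := \lambda$ for $u \in U$, $\lambda \in K$. Then $$0 \to U \to \tilde U \xrightarrow{\ \pi\ } K \to 0$$ (the first map being the inclusion) is a short exact sequence of $G$-modules which does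 not split.
   Context: For a linear algebraic group $G$ over $K$, a $G$-module is a finite-dimensional $K$-vector space on which $G$ acts linearly and algebraically. The one-dimensional module $K$ always carries the trivial $G$-action. For $G$-modules $V,W$ the space $\mathrm{Hom}_K(V,W)$ is a $G$-module via $\sigma f := \sigma\circ f\circ\sigma^{-1}$ for $\sigma\in G$; its submodules carry the restricted action. A short exact sequence $0\to U\to\tilde U\to K\to 0$ of $G$-modules splits if the image of $U$ has a $G$-invariant complement in $\tilde U$. *)

(* Defs.v *)
From HB Require Import structures.
From mathcomp Require Import all_boot all_algebra.
From mathcomp Require Export mpoly.

Set Implicit Arguments.
Unset Strict Implicit.
Unset Printing Implicit Defensive.

Import GRing.Theory.
Local Open Scope ring_scope.

Section LinearAlgebraicGroups.
Variables (K : fieldType) (n : nat).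

(* A polynomial in the n * n matrix entries; the entry (i, j) is the variable
   of index [mxvec_index i j]. *)
Definition mx_eval (P : {mpoly K[n * n]}) (A : 'M[K]_n) : K :=
  P.@[fun k => mxvec A 0 k].

(* A Zariski closed subgroup of GL_n(K); Zariski closed is understood relative
   to GL_n(K). *)
Record closed_subgroup (G : 'M[K]_n -> Prop) : Prop := ClosedSubgroup {
  csg_unit : forall A, G A -> A \in unitmx;
  csg_one : G 1%:M;
  csg_mul : forall A B, G A -> G B -> G (A *m B);
  csg_inv : forall A, G A -> G (invmx A);
  csg_closed : exists S : {mpoly K[n * n]} -> Prop,
    forall A, A \in unitmx ->
      (G A <-> forall P, S P -> mx_eval P A = 0)
}.

(* The coordinate ring of a closed subgroup of GL_n is a quotient of
   K[x_ij, 1/det]. *)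
Definition regular_on (G : 'M[K]_n -> Prop) (f : 'M[K]_n -> K) : Prop :=
  exists (P : {mpoly K[n * n]}) (d : nat),
    forall A, G A -> f A = mx_eval P A / (\det A) ^+ d.

Variable G : 'M[K]_n -> Prop.

(* Actions are given on all of 'M[K]_n, but only their values on G matter. *)
Definition action (V : vectType K) := 'M[K]_n -> 'End(V).

Record gmodule (V : vectType K) (rho : action V) : Prop := GModule {
  gmod_one : forall v, rho 1%:M v = v;
  gmod_mul : forall A B, G A -> G B ->
    forall v, rho (A *m B) v = rho A (rho B v);
  gmod_algebraic : forall (v : V) (l : 'Hom(V, K^o)),
    regular_on G (fun A => l (rho A v))
}.

Definition submodule (V : vectType K) (rho : action V) (U : {vspace V}) :=
  forall A, G A -> forall u, u \in U -> rho A u \in U.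

(* The restriction of rho to U; the projection [vsproj U] only retypes
   [rho A u] when U is G-stable. *)
Definition sub_action (V : vectType K) (rho : action V) (U : {vspace V}) :
    action (subvs_of U) :=
  fun A => (linfun (vsproj U) \o rho A \o linfun vsval)%VF.

Definition trivial_action : action K^o := fun=> \1%VF.

Definition conj_fun (V W : vectType K) (g : 'End(W)) (h : 'End(V))
  (f : 'Hom(V, W)) : 'Hom(V, W) := (g \o f \o h)%VF.

Lemma conj_fun_is_linear (V W : vectType K) (g : 'End(W)) (h : 'End(V)) :
  linear (@conj_fun V W g h).
Proof.
move=> a f1 f2; apply/lfunP=> v; rewrite /conj_fun.
by rewrite !(add_lfunE, scale_lfunE, comp_lfunE) linearP.
Qed.

HB.instance Definition _ (V W : vectType K) (g : 'End(W)) (h : 'End(V)) :=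
  GRing.isLinear.Build K 'Hom(V, W) 'Hom(V, W) _ (@conj_fun V W g h)
    (@conj_fun_is_linear V W g h).

Definition hom_action (V W : vectType K) (rhoV : action V) (rhoW : action W) :
    action 'Hom(V, W) :=
  fun A => linfun (conj_fun (rhoW A) (rhoV (invmx A))).

Lemma hom_actionE (V W : vectType K) (rhoV : action V) (rhoW : action W) A f v :
  hom_action rhoV rhoW A f v = rhoW A (f (rhoV (invmx A) v)).
Proof. by rewrite lfunE !lfunE /= lfunE. Qed.

Definition equivariant (V W : vectType K) (rhoV : action V) (rhoW : action W)
    (f : 'Hom(V, W)) : Prop :=
  forall A, G A -> forall v, f (rhoV A v) = rhoW A (f v).

(* 0 -> X --i--> Y --q--> Z -> 0 *)
Record short_exact (X Y Z : vectType K) (rhoX : action X) (rhoY : action Y)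
    (rhoZ : action Z) (i : 'Hom(X, Y)) (q : 'Hom(Y, Z)) : Prop := ShortExact {
  ses_modX : gmodule rhoX;
  ses_modY : gmodule rhoY;
  ses_modZ : gmodule rhoZ;
  ses_i : equivariant rhoX rhoY i;
  ses_q : equivariant rhoY rhoZ q;
  ses_inj : lker i = 0%VS;
  ses_exact : limg i = lker q;
  ses_surj : limg q = fullv
}.

Definition splits (X Y : vectType K) (rhoY : action Y) (i : 'Hom(X, Y)) : Prop :=
  exists C : {vspace Y},
    [/\ submodule rhoY C, (limg i + C)%VS = fullv & (limg i :&: C)%VS = 0%VS].

End LinearAlgebraicGroups.

Section Forms.
(* There are n = m.+2 variables, so n ranges over all integers n >= 2. *)
Variables (K : fieldType) (m p : nat).

Local Notation V := (dhomog m.+2 K p).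

(* A . x_j = \sum_i a_ij x_i *)
Definition linear_forms (A : 'M[K]_m.+2) : m.+2.-tuple {mpoly K[m.+2]} :=
  [tuple \sum_i A i j *: 'X_i | j < m.+2].

Lemma subst_homog A (f : V) :
  (mpoly_of_dhomog f \mPo linear_forms A) \is p.-homog.
Proof.
case: f => f /= /dhomogP hf; rewrite comp_mpolyEX big_seq rpred_sum // => e /hf ep.
apply: rpredZ; rewrite comp_mpolyX -[p]ep /= mdegE.
apply: (big_ind2 (fun (q : {mpoly K[m.+2]}) (d : nat) => q \is d.-homog)).
- exact: dhomog1.
- by move=> q d q' d' hq hq'; apply: dhomogM.
move=> i _; rewrite tnth_mktuple -[X in X.-homog]mul1n; apply: dhomogMn.
by rewrite rpred_sum // => j _; rewrite rpredZ // dhomogX /= mdeg1.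
Qed.

Definition subst_form A (f : V) : V := DHomog (subst_homog A f).

Lemma subst_form_is_linear A : linear (subst_form A).
Proof. by move=> a f g; apply: val_inj; rewrite /= comp_mpolyD comp_mpolyZ. Qed.

HB.instance Definition _ A :=
  GRing.isLinear.Build K V V _ (subst_form A) (@subst_form_is_linear A).

Definition form_action : action m.+2 V := fun A => linfun (subst_form A).

Lemma form_actionE A (f : V) :
  form_action A f = (mpoly_of_dhomog f \mPo linear_forms A) :> {mpoly K[m.+2]}.
Proof. by rewrite lfunE. Qed.

Lemma monomial_homog (e : 'X_{1..m.+2}) (ep : mdeg e = p) :
  ('X_[e] : {mpoly K[m.+2]}) \is p.-homog.
Proof. by rewrite dhomogX /= ep. Qed.

Definition monomial (e : 'X_{1..m.+2}) (ep : mdeg e = p) : V :=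
  DHomog (monomial_homog ep).

Lemma mdeg_pow (i : 'I_m.+2) : mdeg (U_(i) *+ p)%MM = p.
Proof. by rewrite mdegMn mdeg1 mul1n. Qed.

Definition xpow (i : 'I_m.+2) : V := monomial (mdeg_pow i).

Lemma xpowE i : xpow i = 'X_i ^+ p :> {mpoly K[m.+2]}.
Proof. by rewrite /= mpolyXn. Qed.

Definition W : {vspace V} := <<[seq xpow i | i <- enum 'I_m.+2]>>%VS.

Local Notation H := 'Hom(V, subvs_of W).

Definition W_action : action m.+2 (subvs_of W) := sub_action form_action W.

Definition VW_action : action m.+2 H := hom_action form_action W_action.

Definition restrW (f : H) : 'End(subvs_of W) := (f \o linfun vsval)%VF.

Lemma restrW_is_linear : linear restrW.
Proof. by move=> a f g; rewrite /restrW comp_lfunDl comp_lfunZl. Qed.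

HB.instance Definition _ :=
  GRing.isLinear.Build K H 'End(subvs_of W) _ restrW restrW_is_linear.

Definition U : {vspace H} := lker (linfun restrW).

Lemma mem_U (f : H) : reflect (forall w, w \in W -> f w = 0) (f \in U).
Proof.
rewrite memv_ker lfunE /=; apply: (iffP eqP) => [f0 w Ww | f0].
  by move/lfunP/(_ (vsproj W w)): f0; rewrite !lfunE /= lfunE /= vsprojK.
by apply/lfunP=> w; rewrite !lfunE /= lfunE /= f0 ?subvsP.
Qed.

(* f |-> \sum_i (coefficient of x_i^p in f) x_i^p; lemmas [iotaH_W] and
   [iotaH_monomial] give its values on W and on the other monomials. *)
Definition iotaH_fun (f : V) : subvs_of W :=
  \sum_(i < m.+2) f@_(U_(i) *+ p)%MM *: vsproj W (xpow i).

Lemma iotaH_fun_is_linear : linear iotaH_fun.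
Proof.
move=> a f g; rewrite /iotaH_fun scaler_sumr -big_split /=; apply: eq_bigr => i _.
by rewrite mcoeffD mcoeffZ scalerDl scalerA.
Qed.

HB.instance Definition _ :=
  GRing.isLinear.Build K V (subvs_of W) _ iotaH_fun iotaH_fun_is_linear.

Definition iotaH : H := linfun iotaH_fun.

Lemma xpow_W i : xpow i \in W.
Proof. by apply/memv_span/map_f; rewrite mem_enum. Qed.

Hypothesis p_gt0 : (0 < p)%N.

Lemma iotaH_xpow i : iotaH (xpow i) = vsproj W (xpow i).
Proof.
rewrite lfunE /= /iotaH_fun (bigD1 i) //= mcoeffX eqxx scale1r big1 ?addr0 //.
move=> j ji; rewrite mcoeffX; case: eqP => [/mnmP/(_ i)|]; last by rewrite scale0r.
rewrite !mulmnE !mnm1E eqxx (negPf ji) mul1n mul0n => p0.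
by have := p_gt0; rewrite [X in (_ < X)%N]p0.
Qed.

Lemma iotaH_W w : w \in W -> iotaH w = vsproj W w.
Proof.
move=> Ww; rewrite (coord_span Ww) !linear_sum; apply: eq_bigr => k _.
rewrite !linearZ /=; congr (_ *: _).
have : [seq xpow i | i <- enum 'I_m.+2]`_k \in [seq xpow i | i <- enum 'I_m.+2].
  by apply: mem_nth; rewrite size_map -cardE ltn_ord.
by case/mapP => i _ /= ->; rewrite iotaH_xpow.
Qed.

Lemma iotaH_monomial e (ep : mdeg e = p) :
  monomial ep \notin W -> iotaH (monomial ep) = 0.
Proof.
move=> nW; rewrite lfunE /= /iotaH_fun big1 // => i _.
rewrite mcoeffX; case: eqP => [ei|]; last by rewrite scale0r.
case/negP: nW; suff -> : monomial ep = xpow i by apply: xpow_W.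
by apply: val_inj; rewrite /= ei.
Qed.

Lemma iotaHZ_U a : a *: iotaH \in U -> a = 0.
Proof.
move/mem_U/(_ _ (xpow_W ord0)); rewrite lfunE /= iotaH_xpow.
move/(congr1 vsval); rewrite linearZ linear0 /= vsprojK ?xpow_W //.
move/(congr1 (fun f : V => f@_(U_(ord0) *+ p)%MM)).
by rewrite mcoeffZ mcoeffX eqxx mulr1 mcoeff0.
Qed.

Definition Ut : {vspace H} := (U + <[iotaH]>)%VS.

Lemma U_iotaH_disjoint : (<[iotaH]> :&: U)%VS = 0%VS.
Proof.
apply/eqP; rewrite -subv0; apply/subvP => f; rewrite memv_cap => /andP[].
by case/vlineP=> a -> /iotaHZ_U ->; rewrite scale0r mem0v.
Qed.

Definition U_incl : 'Hom(subvs_of U, subvs_of Ut) :=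
  (linfun (vsproj Ut) \o linfun vsval)%VF.

Lemma U_inclE u : vsval (U_incl u) = vsval u.
Proof.
by rewrite lfunE /= !lfunE /= vsprojK // (subvP (addvSl _ _)) ?subvsP.
Qed.

(* The coefficient on iotaH of the projection to K iotaH along U; see [Ut_projE]. *)
Definition Ut_proj : 'Hom(subvs_of Ut, K^o) :=
  (linfun (coord [tuple iotaH] ord0 : H -> K^o) \o daddv_pi <[iotaH]> U
     \o linfun vsval)%VF.

Lemma Ut_projE (f : subvs_of Ut) u a :
  u \in U -> vsval f = u + a *: iotaH -> Ut_proj f = a.
Proof.
move=> Uu fE; rewrite lfunE /= lfunE /= lfunE /= lfunE /= fE linearD /=.
have -> : daddv_pi <[iotaH]> U u = 0.
  have := daddv_pi_add U_iotaH_disjoint (subvP (addvSr <[iotaH]>%VS U) _ Uu).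
  rewrite [X in _ + X = _]daddv_pi_id ?[(U :&: _)%VS]capvC ?U_iotaH_disjoint //.
  by move/(canRL (addrK _)); rewrite subrr.
rewrite add0r daddv_pi_id ?U_iotaH_disjoint ?memvZ ?memv_line // linearZ /=.
suff -> : coord [tuple iotaH] ord0 iotaH = 1 by rewrite [LHS]mulr1.
have /(coord_free ord0 ord0) : free [tuple iotaH].
  rewrite /= -[X in free X]/([:: iotaH]) seq1_free; apply/eqP => i0.
  have /iotaHZ_U/eqP : 1 *: iotaH \in U by rewrite i0 scaler0 mem0v.
  by rewrite oner_eq0.
by rewrite eqxx.
Qed.

End Forms.

Section Elements.
Variables (K : fieldType) (m : nat).

Definition top_left (a b c d : K) : 'M[K]_2 :=
  \matrix_(i, j) if i == 0 then (if j == 0 then a else b)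
                 else (if j == 0 then c else d).

(* block_mx has type 'M_(2 + m), which is convertible to 'M_m.+2. *)
Definition elt_char2 (a : K) : 'M[K]_m.+2 :=
  block_mx (top_left a (a + 1) (a + 1) a) 0 0 (1%:M : 'M_m).

Definition elt_odd : 'M[K]_m.+2 :=
  block_mx (top_left 1 1 0 1) 0 0 (1%:M : 'M_m).

End Elements.

(* Main.v *)
From HB Require Import structures.
Require Import Defs.
From mathcomp Require Import all_boot all_algebra.
From mathcomp Require Import ring.

(** Exactness is formal once the spaces are known to be G-modules: G fixes
[iotaH] modulo [U] ([iotaH_invariant_mod_U]), because both [iotaH] and its
translates restrict to the identity of [W].  Algebraicity of the actions comes
down to the fact that the regular functions on G form a ring, stable under
composition with inversion ([regular_invmx]); hence forms, subspaces and
Hom-spaces all have regular matrix coefficients.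

For the failure of splitting, an invariant complement of [U] would contain a
G-fixed element of [iotaH + U], that is, a G-equivariant projection phi of the
forms of degree p onto [W] ([splits_equivariant_projection]).  On [W] the group
acts through the p-th powers of the matrix entries, so equivariance under one
group element is a linear relation between the coefficients of
phi(v) on the x_i^p.

If p is odd, let g fix x_0 and send x_1 to x_0 + x_1.  Then (g - 1)^2 = 0 on
[W], while (g - 1)^2 (x_0^(p-2) x_1^2) = 2 x_0^p is a nonzero element of [W],
which phi fixes ([odd_obstruction]).

If p = 2, let v = x_0 x_1 and let b be the sum of the coefficients of phi(v) on
x_0^2 and x_1^2.  For the element g with parameter a,
g v = v + a (a + 1) (x_0^2 + x_1^2), and comparing coefficients of x_0^2 in
phi(g v) = g phi(v) gives a (a + 1) = b (a + 1)^2.  So for a distinct from 1 one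
has a = b (a + 1) ([char2_obstruction]), which determines a; two parameters
other than 1 are one too many. *)

Set Implicit Arguments.
Unset Strict Implicit.
Unset Printing Implicit Defensive.

Import GRing.Theory.
Local Open Scope ring_scope.

(** * Regular functions on a closed subgroup *)

Section RegularFunctions.
Variables (K : fieldType) (n : nat) (G : 'M[K]_n -> Prop).
Hypothesis hG : closed_subgroup G.

Local Notation regular := (regular_on G).

Lemma det_neq0 A : G A -> \det A != 0.
Proof. by move/(csg_unit hG); rewrite unitmxE unitfE. Qed.

Lemma mx_evalD P Q (A : 'M[K]_n) : mx_eval (P + Q) A = mx_eval P A + mx_eval Q A.
Proof. exact: mevalD. Qed.

Lemma mx_evalM P Q (A : 'M[K]_n) : mx_eval (P * Q) A = mx_eval P A * mx_eval Q A.
Proof. exact: mevalM. Qed.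

Lemma mx_evalC c (A : 'M[K]_n) : mx_eval c%:MP A = c.
Proof. exact: mevalC. Qed.

Definition det_mpoly : {mpoly K[n * n]} :=
  \det (\matrix_(i, j) 'X_(mxvec_index i j) : 'M_n).

Lemma mx_eval_entry i j (A : 'M[K]_n) : mx_eval 'X_(mxvec_index i j) A = A i j.
Proof. by rewrite /mx_eval mevalXU mxvecE. Qed.

Lemma mx_eval_det A : mx_eval det_mpoly A = \det A.
Proof.
rewrite /mx_eval /det_mpoly -det_map_mx; congr (\det _).
by apply/matrixP => i j; rewrite !mxE; apply: mx_eval_entry.
Qed.

Lemma mx_evalX P d (A : 'M[K]_n) : mx_eval (P ^+ d) A = mx_eval P A ^+ d.
Proof. exact: rmorphXn. Qed.

Lemma eq_regular f g : (forall A, G A -> f A = g A) -> regular g -> regular f.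
Proof. by move=> fg [P [d gE]]; exists P, d => A GA; rewrite fg ?gE. Qed.

Lemma regular_cst c : regular (fun=> c).
Proof. by exists c%:MP, 0%N => A _; rewrite mx_evalC expr0 divr1. Qed.

Lemma regular_entry i j : regular (fun A => A i j).
Proof.
by exists 'X_(mxvec_index i j), 0%N => A _; rewrite mx_eval_entry expr0 divr1.
Qed.

Lemma regular_det_inv : regular (fun A => (\det A)^-1).
Proof.
by exists 1%:MP, 1%N => A _; rewrite mx_evalC expr1 div1r.
Qed.

(** Bring both fractions over the common denominator [\det A ^+ (d + e)]; the
determinant is itself a polynomial in the entries. *)
Lemma regularD f g : regular f -> regular g -> regular (fun A => f A + g A).
Proof.
move=> [P [d fE]] [Q [e gE]].
exists (P * det_mpoly ^+ e + Q * det_mpoly ^+ d), (d + e)%N => A GA.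
have D0 := det_neq0 GA.
rewrite fE // gE // addf_div ?expf_neq0 // mx_evalD !mx_evalM !mx_evalX.
by rewrite !mx_eval_det exprD.
Qed.

Lemma regularM f g : regular f -> regular g -> regular (fun A => f A * g A).
Proof.
move=> [P [d fE]] [Q [e gE]]; exists (P * Q), (d + e)%N => A GA.
by rewrite fE // gE // mx_evalM exprD mulf_div.
Qed.

Lemma regularX f k : regular f -> regular (fun A => f A ^+ k).
Proof.
move=> rf; elim: k => [|k IH]; first exact: regular_cst.
by apply: eq_regular (regularM rf IH) => A _; rewrite exprS.
Qed.

Lemma regular_sum I (r : seq I) (Q : pred I) f :
  (forall i, Q i -> regular (f i)) -> regular (fun A => \sum_(i <- r | Q i) f i A).
Proof.
move=> rf; elim: r => [|i r IH].
  by apply: eq_regular (regular_cst 0) => A _; rewrite big_nil.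
case Qi: (Q i); last by apply: eq_regular IH => A _; rewrite big_cons Qi.
by apply: eq_regular (regularD (rf i Qi) IH) => A _; rewrite big_cons Qi.
Qed.

Lemma regular_prod I (r : seq I) (Q : pred I) f :
  (forall i, Q i -> regular (f i)) -> regular (fun A => \prod_(i <- r | Q i) f i A).
Proof.
move=> rf; elim: r => [|i r IH].
  by apply: eq_regular (regular_cst 1) => A _; rewrite big_nil.
case Qi: (Q i); last by apply: eq_regular IH => A _; rewrite big_cons Qi.
by apply: eq_regular (regularM (rf i Qi) IH) => A _; rewrite big_cons Qi.
Qed.

Lemma regular_det k (M : 'M[K]_n -> 'M[K]_k) :
  (forall i j, regular (fun A => M A i j)) -> regular (fun A => \det (M A)).
Proof.
move=> rM; apply: regular_sum => s _; apply: regularM; first exact: regular_cst.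
exact: regular_prod.
Qed.

Lemma regular_meval k (P : {mpoly K[k]}) (v : 'M[K]_n -> 'I_k -> K) :
  (forall i, regular (fun A => v A i)) -> regular (fun A => P.@[v A]).
Proof.
move=> rv; apply: eq_regular (fun A _ => mevalE (v A) P) _.
apply: regular_sum => e _; apply: regularM; first exact: regular_cst.
by apply: regular_prod => i _; apply: regularX.
Qed.

(** Cramer's rule. *)
Lemma regular_invmx_entry i j : regular (fun A => invmx A i j).
Proof.
apply: (@eq_regular _ (fun A => (\det A)^-1 * \adj A i j)) => [A GA|].
  by rewrite /invmx (csg_unit hG GA) mxE.
apply: regularM; first exact: regular_det_inv.
apply: (@eq_regular _ (fun A => (-1) ^+ (j + i) * \det (row' j (col' i A)))).
  by move=> A _; rewrite mxE.
apply: regularM; first exact: regular_cst.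
apply: regular_det => k l.
by apply: eq_regular (regular_entry (lift j k) (lift i l)) => A _; rewrite !mxE.
Qed.

(** Composing with inversion turns the denominator [\det A ^+ d] into a factor. *)
Lemma regular_invmx f : regular f -> regular (fun A => f (invmx A)).
Proof.
move=> [P [d fE]].
apply: (@eq_regular _ (fun A => mx_eval P (invmx A) * \det A ^+ d)) => [A GA|].
  by rewrite fE; [rewrite det_inv exprVn invrK | apply: csg_inv].
apply: regularM.
  apply: regular_meval => k; case/mxvec_indexP: k => i j.
  apply: eq_regular (regular_invmx_entry i j) => A _; exact: mxvecE.
by apply: regularX; apply: regular_det => i j; apply: regular_entry.
Qed.

End RegularFunctions.

(** * Modules built from modules *)

Section Modules.
Variables (K : fieldType) (n : nat) (G : 'M[K]_n -> Prop).
Hypothesis hG : closed_subgroup G.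

Lemma gmodule_trivial : gmodule G (@trivial_action K n).
Proof.
split=> [v|A B _ _ v|v l]; rewrite ?lfunE ?lfunE //.
by apply: eq_regular (regular_cst G (l v)) => A _; rewrite lfunE.
Qed.

Lemma sub_actionE (V : vectType K) (rho : action n V) (X : {vspace V}) A (x : subvs_of X) :
  submodule G rho X -> G A -> vsval (sub_action rho X A x) = rho A (vsval x).
Proof.
by move=> sX GA; rewrite lfunE /= !lfunE /= lfunE /= vsprojK // sX ?subvsP.
Qed.

Lemma gmodule_sub (V : vectType K) (rho : action n V) (X : {vspace V}) :
  gmodule G rho -> submodule G rho X -> gmodule G (sub_action rho X).
Proof.
move=> [r1 rM ralg] sX; split=> [x|A B GA GB x|x l].
- by apply: val_inj; rewrite /= sub_actionE ?r1 //; apply: csg_one.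
- by apply: val_inj; rewrite /= !sub_actionE ?rM //; apply: csg_mul.
apply: (@eq_regular _ _ _ _ _ _ (ralg (vsval x) (l \o linfun (vsproj X))%VF)).
by move=> A GA; rewrite [RHS]lfunE /= [X in _ = l X]lfunE /= -(sub_actionE _ sX GA) vsvalK.
Qed.

(** The matrix units of Hom(V, W): they turn a linear form on Hom(V, W) into a
family of linear forms on W. *)
Definition elementary_fun (V W : vectType K) (i : 'I_(\dim {:V})) (w : W) (v : V) :=
  coord (vbasis {:V}) i v *: w.

Lemma elementary_fun_is_linear (V W : vectType K) i (w : W) :
  linear (@elementary_fun V W i w).
Proof. by move=> a x y; rewrite /elementary_fun linearP scalerDl scalerA. Qed.

HB.instance Definition _ (V W : vectType K) i w :=
  GRing.isLinear.Build K V W _ (@elementary_fun V W i w)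
    (@elementary_fun_is_linear V W i w).

Definition elementary_hom (V W : vectType K) i w : 'Hom(V, W) :=
  linfun (@elementary_fun V W i w).

Lemma elementary_homE (V W : vectType K) i w v :
  @elementary_hom V W i w v = coord (vbasis {:V}) i v *: w.
Proof. exact: lfunE. Qed.

Lemma elementary_hom_is_linear (V W : vectType K) i : linear (@elementary_hom V W i).
Proof.
move=> a w1 w2; apply/lfunP => v.
by rewrite add_lfunE scale_lfunE !elementary_homE scalerDr !scalerA [a * _]mulrC.
Qed.

HB.instance Definition _ (V W : vectType K) i :=
  GRing.isLinear.Build K W 'Hom(V, W) _ (@elementary_hom V W i)
    (@elementary_hom_is_linear V W i).

Lemma hom_decomp (V W : vectType K) (f : 'Hom(V, W)) :
  f = \sum_i elementary_hom i (f (vbasis {:V})`_i).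
Proof.
apply/lfunP => v; rewrite sum_lfunE [in LHS](coord_vbasis (memvf v)) linear_sum.
by apply: eq_bigr => i _; rewrite linearZ elementary_homE.
Qed.

(** The matrix coefficients of the action on Hom(V, W) are sums of products of a
matrix coefficient of W at A and one of V at the inverse of A. *)
Lemma gmodule_hom (V W : vectType K) (rhoV : action n V) (rhoW : action n W) :
  gmodule G rhoV -> gmodule G rhoW -> gmodule G (hom_action rhoV rhoW).
Proof.
move=> [v1 vM valg] [w1 wM walg]; split=> [f|A B GA GB f|f l].
- by apply/lfunP => v; rewrite hom_actionE invmx1 v1 w1.
- apply/lfunP => v; rewrite !hom_actionE wM //.
  have -> : invmx (A *m B) = invmx B *m invmx A.
    have [uA uB] := (csg_unit hG GA, csg_unit hG GB).
    have uAB : A *m B \in unitmx by rewrite unitmx_mul uA.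
    rewrite -[LHS]mulmx1; apply: (canLR (mulKmx uAB)).
    by rewrite mulmxA -[A *m B *m _]mulmxA mulmxV // mulmx1 mulmxV.
  by rewrite vM //; apply: csg_inv.
set e := vbasis {:V}.
pose c (i j : 'I_(\dim {:V})) A : K := coord e j (rhoV (invmx A) e`_i).
pose d (i j : 'I_(\dim {:V})) A : K := l (elementary_hom i (rhoW A (f e`_j))).
have E A : l (hom_action rhoV rhoW A f) = \sum_i \sum_j c i j A * d i j A.
  rewrite [hom_action _ _ _ _]hom_decomp linear_sum; apply: eq_bigr => i _.
  rewrite hom_actionE [rhoV _ _](coord_vbasis (memvf _)) !linear_sum.
  by apply: eq_bigr => j _; rewrite !linearZ.
apply: eq_regular (fun A _ => E A) _.
apply: (regular_sum hG) => i _; apply: regular_sum => // j _; apply: regularM.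
  have rc := regular_invmx hG (valg e`_i (linfun (coord e j : V -> K^o))).
  by apply: eq_regular rc => A _; rewrite lfunE.
pose L := linfun (l \o elementary_hom i : W -> K^o).
apply: eq_regular (walg (f e`_j) L) => A GA; by rewrite lfunE.
Qed.

End Modules.

(** * Forms as a module *)

Lemma comp_mpolyA (R : comNzRingType) (n k l : nat) (P : {mpoly R[n]})
    (lq : n.-tuple {mpoly R[k]}) (lr : k.-tuple {mpoly R[l]}) :
  (P \mPo lq) \mPo lr = P \mPo [tuple tnth lq i \mPo lr | i < n].
Proof.
rewrite (comp_mpolyEX P lq) [RHS]comp_mpolyEX raddf_sum /=; apply: eq_bigr => e _.
rewrite comp_mpolyZ !comp_mpolyX rmorph_prod; congr (_ *: _).
by apply: eq_bigr => i _; rewrite tnth_mktuple rmorphXn.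
Qed.

Section RegularCoefficients.
Variables (K : fieldType) (n : nat) (G : 'M[K]_n -> Prop) (k : nat).
Hypothesis hG : closed_subgroup G.

(** Regularity of a polynomial-valued map is asked of each coefficient separately;
the convolution formula [mcoeffM] then gives stability under products. *)
Definition coef_regular (F : 'M[K]_n -> {mpoly K[k]}) :=
  forall e, regular_on G (fun A => (F A)@_e).

Lemma eq_coef_regular F1 F2 :
  (forall A, F1 A = F2 A) -> coef_regular F2 -> coef_regular F1.
Proof. by move=> E r e; apply: eq_regular (r e) => A _; rewrite E. Qed.

Lemma coef_regular_cst P : coef_regular (fun=> P).
Proof. by move=> e; apply: regular_cst. Qed.

Lemma coef_regular_sum I (r : seq I) F :
  (forall i, coef_regular (F i)) -> coef_regular (fun A => \sum_(i <- r) F i A).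
Proof.
move=> rF e.
apply: (@eq_regular _ _ _ _ (fun A => \sum_(i <- r) (F i A)@_e)) => [A _|].
  by rewrite raddf_sum.
by apply: (regular_sum hG) => i _; apply: rF.
Qed.

Lemma coef_regularM F1 F2 : coef_regular F1 -> coef_regular F2 ->
  coef_regular (fun A => F1 A * F2 A).
Proof.
move=> r1 r2 e; apply: eq_regular (fun A _ => mcoeffM (F1 A) (F2 A) e) _.
by apply: (regular_sum hG) => d _; apply: regularM.
Qed.

Lemma coef_regularZ f F : regular_on G f -> coef_regular F ->
  coef_regular (fun A => f A *: F A).
Proof.
move=> rf rF e; apply: eq_regular (regularM rf (rF e)) => A _.
by rewrite mcoeffZ.
Qed.

Lemma coef_regularX F d : coef_regular F -> coef_regular (fun A => F A ^+ d).
Proof.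
move=> rF; elim: d => [|d IH]; first exact: coef_regular_cst.
by apply: eq_coef_regular (coef_regularM rF IH) => A; rewrite exprS.
Qed.

Lemma coef_regular_prod I (r : seq I) F :
  (forall i, coef_regular (F i)) -> coef_regular (fun A => \prod_(i <- r) F i A).
Proof.
move=> rF; elim: r => [|i r IH].
  by apply: eq_coef_regular (coef_regular_cst 1) => A; rewrite big_nil.
by apply: eq_coef_regular (coef_regularM (rF i) IH) => A; rewrite big_cons.
Qed.

End RegularCoefficients.

Section FormModules.
Variables (K : fieldType) (m p : nat) (G : 'M[K]_m.+2 -> Prop).
Hypothesis hG : closed_subgroup G.
Local Notation V := (dhomog m.+2 K p).
Local Notation n := m.+2.

Lemma coef_regular_subst (P : {mpoly K[n]}) :
  coef_regular G (fun A => P \mPo linear_forms A).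
Proof.
apply: eq_coef_regular (fun A => comp_mpolyEX P (linear_forms A)) _.
apply: (coef_regular_sum hG) => e; apply: coef_regularZ; first exact: regular_cst.
apply: eq_coef_regular (fun A => comp_mpolyX e (linear_forms A)) _.
apply: (coef_regular_prod hG) => i; apply: (coef_regularX hG).
apply: (@eq_coef_regular _ _ _ _ _ (fun A => \sum_j A j i *: 'X_j)) => [A|].
  by rewrite tnth_mktuple.
apply: (coef_regular_sum hG) => j; apply: coef_regularZ; first exact: regular_entry.
exact: coef_regular_cst.
Qed.

(** The exponents of degree at most p form a finite type, and those of degree
less than p have coefficient 0 in w, so the default value 0 of [indhomog] on
them is harmless. *)
Lemma dhomog_monomial_sum (w : V) :
  w = \sum_(e : 'X_{1..n < p.+1}) w@_e *: indhomog p 'X_[e].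
Proof.
apply: val_inj; rewrite /= linear_sum /=.
have sw : (msize w <= p.+1)%N.
  rewrite msizeE; apply/bigmax_leqP_seq => e he _.
  by rewrite (dhomog_mf (dhomog_is_dhomog w) he).
rewrite {1}(mpolywE sw); apply: eq_bigr => e _.
have [ep|ep] := eqVneq (mdeg e) p.
  by rewrite insubdK // [_ \in _]dhomogX /= ep.
by rewrite (dhomog_nemf_coeff (dhomog_is_dhomog w) ep) !scale0r.
Qed.

Lemma linear_forms1 : linear_forms (1%:M : 'M[K]_n) = [tuple 'X_i | i < n].
Proof.
apply: eq_from_tnth => j; rewrite !tnth_mktuple (bigD1 j) //= mxE eqxx scale1r.
by rewrite big1 ?addr0 // => i ij; rewrite mxE (negPf ij) scale0r.
Qed.

Lemma linear_formsM (A B : 'M[K]_n) :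
  linear_forms (A *m B) = [tuple tnth (linear_forms B) j \mPo linear_forms A | j < n].
Proof.
apply: eq_from_tnth => j; rewrite !tnth_mktuple raddf_sum /=.
under [RHS]eq_bigr => k _.
  rewrite comp_mpolyZ comp_mpolyXU -tnth_nth tnth_mktuple scaler_sumr. over.
rewrite exchange_big /=; apply: eq_bigr => i _; rewrite mxE scaler_suml.
by apply: eq_bigr => k _; rewrite scalerA mulrC.
Qed.

Lemma form_gmodule : gmodule G (form_action p).
Proof.
split=> [v|A B GA GB v|v l].
- by apply: val_inj; rewrite /= form_actionE linear_forms1 comp_mpoly_id.
- by apply: val_inj; rewrite /= !form_actionE comp_mpolyA linear_formsM.
apply: (@eq_regular _ _ _ _ (fun A => \sum_(e : 'X_{1..n < p.+1})
  (v \mPo linear_forms A)@_e * (l (indhomog p 'X_[e]) : K))) => [A _|].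
  rewrite [form_action p A v]dhomog_monomial_sum linear_sum form_actionE.
  by apply: eq_bigr => e _; rewrite linearZ.
apply: (regular_sum hG) => e _; apply: regularM; last exact: regular_cst.
exact: coef_regular_subst.
Qed.

Hypothesis charK : p \in [pchar K].

Let p_gt0 : (0 < p)%N.
Proof. by rewrite prime_gt0 // (pcharf_prime charK). Qed.

Lemma mpoly_pchar : p \in [pchar {mpoly K[n]}].
Proof. by rewrite (pchar_lalg {mpoly K[n]}). Qed.

(** Frobenius: the p-th power of a linear form has the p-th powers of its
coefficients. *)
Lemma form_action_xpow (A : 'M[K]_n) (j : 'I_n) :
  form_action p A (xpow K p j) = \sum_i A i j ^+ p *: xpow K p i.
Proof.
apply: val_inj; rewrite /= form_actionE xpowE rmorphXn /= comp_mpolyXU -tnth_nth.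
rewrite tnth_mktuple -(pFrobenius_autE mpoly_pchar) rmorph_sum linear_sum.
apply: eq_bigr => i _; rewrite /= pFrobenius_autE exprZn.
by rewrite mpolyXn.
Qed.

Definition pcoef (i : 'I_n) (w : V) : K := w@_(U_(i) *+ p).

Lemma W_xpow_sum w : w \in W K m p -> w = \sum_i pcoef i w *: xpow K p i.
Proof.
move=> Ww; rewrite -{1}(vsprojK Ww) -(iotaH_W p_gt0 Ww) lfunE /= /iotaH_fun.
by rewrite linear_sum; apply: eq_bigr => i _; rewrite linearZ /= vsprojK ?xpow_W.
Qed.

Lemma pcoef_is_linear i : linear (pcoef i : V -> K^o).
Proof. by move=> a u v; rewrite /pcoef mcoeffD mcoeffZ. Qed.

HB.instance Definition _ i :=
  GRing.isLinear.Build K V K^o _ (pcoef i) (pcoef_is_linear i).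

Lemma pcoefD i : {morph pcoef i : v w / v + w}.
Proof. by move=> v w; apply: mcoeffD. Qed.

Lemma pcoefZ i a v : pcoef i (a *: v) = a * pcoef i v.
Proof. exact: mcoeffZ. Qed.

Lemma pcoef_xpow i j : pcoef i (xpow K p j) = (i == j)%:R.
Proof.
rewrite /pcoef mcoeffX; congr (nat_of_bool _)%:R; apply/eqP/eqP => [E|-> //].
have /mnmP/(_ i) := E; rewrite !mulmnE !mnm1E eqxx mul1n.
by case: eqP => // _; rewrite mul0n => p0; move: p_gt0; rewrite -[X in (_ < X)%N]p0.
Qed.

Lemma W_submodule : submodule G (form_action p) (W K m p).
Proof.
move=> A _ w /W_xpow_sum ->; rewrite linear_sum memv_suml // => j _.
rewrite linearZ memvZ //= form_action_xpow memv_suml // => i _.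
by rewrite memvZ ?xpow_W.
Qed.

Lemma pcoef_form_action A w i : w \in W K m p ->
  pcoef i (form_action p A w) = \sum_j A i j ^+ p * pcoef j w.
Proof.
move=> Ww; rewrite {1}(W_xpow_sum Ww) !linear_sum /=; apply: eq_bigr => j _.
rewrite !linearZ /= form_action_xpow linear_sum (bigD1 i) //= linearZ /=.
rewrite pcoef_xpow eqxx big1 => [|k ki].
  by rewrite addr0 [_ *: 1]mulr1 [LHS]mulrC.
by rewrite linearZ /= pcoef_xpow eq_sym (negPf ki) scaler0.
Qed.

End FormModules.

(** * The extension of K by U *)

Section Extension.
Variables (K : fieldType) (m p : nat) (G : 'M[K]_m.+2 -> Prop).
Hypothesis hG : closed_subgroup G.
Hypothesis charK : p \in [pchar K].
Local Notation V := (dhomog m.+2 K p).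
Local Notation n := m.+2.
Local Notation W := (W K m p).
Local Notation U := (U K m p).
Local Notation Ut := (Ut K m p).
Local Notation iotaH := (iotaH K m p).
Local Notation VW_action := (@VW_action K m p).

Let p_gt0 : (0 < p)%N.
Proof. by rewrite prime_gt0 // (pcharf_prime charK). Qed.

Let W_sub : submodule G (form_action p) W.
Proof. exact: W_submodule. Qed.

Lemma W_actionE A w : G A -> vsval (W_action p A w) = form_action p A (vsval w).
Proof. exact: sub_actionE. Qed.

Lemma form_actionK A (v : V) : G A -> form_action p A (form_action p (invmx A) v) = v.
Proof.
move=> GA; have [f1 fM _] := form_gmodule p hG.
by rewrite -fM ?mulmxV ?f1 ?(csg_unit hG) //; apply: csg_inv.
Qed.

Lemma form_actionVK A (v : V) : G A -> form_action p (invmx A) (form_action p A v) = v.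
Proof.
move=> GA; have [f1 fM _] := form_gmodule p hG.
by rewrite -fM ?mulVmx ?f1 ?(csg_unit hG) //; apply: csg_inv.
Qed.

Lemma VW_gmodule : gmodule G VW_action.
Proof.
have mV := form_gmodule p hG.
by apply: gmodule_hom => //; apply: gmodule_sub.
Qed.

Lemma U_submodule : submodule G VW_action U.
Proof.
move=> A GA f /mem_U f0; apply/mem_U => w Ww.
by rewrite hom_actionE f0 ?linear0 //; apply: W_sub => //; apply: csg_inv.
Qed.

(** Conjugating the identity of [W] gives the identity of [W]. *)
Lemma iotaH_invariant_mod_U A : G A -> VW_action A iotaH - iotaH \in U.
Proof.
move=> GA; apply/mem_U => w Ww; have WAw := W_sub (csg_inv hG GA) Ww.
rewrite add_lfunE opp_lfunE hom_actionE !iotaH_W //; apply/eqP; rewrite subr_eq0.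
by apply/eqP/val_inj; rewrite /= W_actionE // !vsprojK // form_actionK.
Qed.

Lemma mem_UtP f : reflect (exists2 u, u \in U & exists a, f = u + a *: iotaH) (f \in Ut).
Proof.
apply: (iffP memv_addP) => [[u Uu [_ /vlineP[a ->] ->]]|[u Uu [a ->]]].
  by exists u => //; exists a.
by exists u => //; exists (a *: iotaH); rewrite ?memvZ ?memv_line.
Qed.

Lemma VW_action_Ut A u a : G A -> u \in U ->
  exists2 u', u' \in U & VW_action A (u + a *: iotaH) = u' + a *: iotaH.
Proof.
move=> GA Uu; exists (VW_action A u + a *: (VW_action A iotaH - iotaH)).
  by rewrite memvD ?memvZ ?iotaH_invariant_mod_U // U_submodule.
by rewrite linearD linearZ /= scalerBr addrA subrK.
Qed.

Lemma Ut_submodule : submodule G VW_action Ut.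
Proof.
move=> A GA _ /mem_UtP[u Uu [a ->]]; apply/mem_UtP.
by have [u' Uu' ->] := VW_action_Ut a GA Uu; exists u' => //; exists a.
Qed.

Lemma limg_U_incl f : (f \in limg (U_incl K m p)) = (vsval f \in U).
Proof.
apply/memv_imgP/idP => [[u _ ->]|Uf]; first by rewrite U_inclE subvsP.
by exists (vsproj U (vsval f)); rewrite ?memvf //; apply: val_inj; rewrite /= U_inclE vsprojK.
Qed.

Lemma U_Ut_short_exact : short_exact G (sub_action VW_action U)
  (sub_action VW_action Ut) (@trivial_action K n) (U_incl K m p) (Ut_proj K m p).
Proof.
have mVW := VW_gmodule; have [sU sUt] := (U_submodule, Ut_submodule).
split; [exact: gmodule_sub|exact: gmodule_sub|exact: gmodule_trivial| | | | |].
- move=> A GA u; apply: val_inj.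
  by rewrite /= U_inclE (sub_actionE _ sU GA) (sub_actionE _ sUt GA) U_inclE.
- move=> A GA f; rewrite [RHS]lfunE /=; have /mem_UtP[u Uu [a fE]] := subvsP f.
  have [u' Uu' AfE] := VW_action_Ut a GA Uu.
  rewrite (Ut_projE p_gt0 Uu fE); apply: (Ut_projE p_gt0 Uu').
  by rewrite (sub_actionE _ sUt GA) fE.
- apply/eqP/lker0P => u1 u2 /(congr1 vsval); rewrite !U_inclE; exact: val_inj.
- apply/vspaceP => f; rewrite limg_U_incl memv_ker.
  have /mem_UtP[u Uu [a fE]] := subvsP f.
  rewrite (Ut_projE p_gt0 Uu fE) fE; apply/idP/eqP => [Uf|->].
    by apply: (@iotaHZ_U K m p); rewrite // -(addKr u (a *: _)) memvD ?memvN.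
  by rewrite scale0r addr0.
apply/vspaceP => a; rewrite memvf; apply/memv_imgP.
exists (vsproj Ut (a *: iotaH)); first exact: memvf.
symmetry; apply: (Ut_projE p_gt0 (mem0v U)); rewrite add0r vsprojK //.
by apply/mem_UtP; exists 0; rewrite ?mem0v //; exists a; rewrite add0r.
Qed.

(** Decompose [iotaH] as an element of [U] plus some c in the complement C.  For
A in G the difference A c - c lies in C, and in [U] because A fixes [iotaH]
modulo [U]; hence it is 0.  So c is equivariant, and it agrees with [iotaH] on
[W]. *)
Lemma splits_equivariant_projection :
  splits G (sub_action VW_action Ut) (U_incl K m p) ->
  exists phi : 'End(V), [/\ forall v, phi v \in W, forall w, w \in W -> phi w = w &
    equivariant G (form_action p) (form_action p) phi].
Proof.
move=> [C [sC CU CI]]; have [sU sUt] := (U_submodule, Ut_submodule).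
have Ui : iotaH \in Ut.
  by apply/mem_UtP; exists 0; rewrite ?mem0v //; exists 1; rewrite add0r scale1r.
have : vsproj Ut iotaH \in (limg (U_incl K m p) + C)%VS by rewrite CU memvf.
case/memv_addP => x; rewrite limg_U_incl => Ux [c Cc /(congr1 vsval)].
rewrite vsprojK // linearD /= => iE.
have cE : vsval c = - vsval x + 1 *: iotaH by rewrite iE scale1r addKr.
have cfix A : G A -> VW_action A (vsval c) = vsval c.
  move=> GA; rewrite -(sub_actionE _ sUt GA); congr vsval.
  apply/eqP; rewrite -subr_eq0 -memv0 -CI memv_cap.
  apply/andP; split; last by rewrite memvB ?sC.
  rewrite limg_U_incl linearB /= (sub_actionE _ sUt GA) cE.
  have [u Uu ->] := VW_action_Ut 1 GA (etrans (memvN _ _) Ux).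
  by rewrite opprD addrACA subrr addr0 memvB ?memvN.
have phiE v : (linfun vsval \o vsval c)%VF v = vsval (vsval c v).
  by rewrite lfunE /= lfunE.
exists (linfun vsval \o vsval c)%VF; split=> [v|w Ww|A GA v]; rewrite !phiE.
- exact: subvsP.
- rewrite cE scale1r add_lfunE opp_lfunE.
  by rewrite (mem_U _ Ux) // oppr0 add0r iotaH_W // vsprojK.
by rewrite -{1}(cfix A GA) hom_actionE form_actionVK // W_actionE.
Qed.

End Extension.

(** * Obstruction to an equivariant projection onto W *)

Lemma mul_sqr_addr (R : comNzRingType) (x y : R) q :
  x ^+ q * (x + y) ^+ 2 = x ^+ q * y ^+ 2 + (x ^+ q.+1 * y *+ 2 + x ^+ q.+2).
Proof. by rewrite ![in RHS]exprS; move: (x ^+ q) => z; ring. Qed.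

(** In characteristic 2 the quadratic form x y is changed by [elt_char2] only by
squares, since a^2 + (a + 1)^2 = 1. *)
Lemma mul_swap_pchar2 (R : comNzRingType) (a x y : R) : 2%N \in [pchar R] ->
  (a * x + (a + 1) * y) * ((a + 1) * x + a * y) =
  x * y + (a * (a + 1) * x ^+ 2 + a * (a + 1) * y ^+ 2).
Proof.
move=> char2; rewrite -[RHS]addr0 -(mulrn_pchar char2 ((a ^+ 2 + a) * x * y)).
by ring.
Qed.

Section Obstruction.
Variables (K : fieldType) (m p : nat) (G : 'M[K]_m.+2 -> Prop).
Hypothesis charK : p \in [pchar K].
Local Notation V := (dhomog m.+2 K p).
Local Notation n := m.+2.
Local Notation W := (W K m p).

Let p_gt0 : (0 < p)%N.
Proof. by rewrite prime_gt0 // (pcharf_prime charK). Qed.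

Definition idx0 : 'I_n := lshift m (0 : 'I_2).
Definition idx1 : 'I_n := lshift m (1 : 'I_2).
Local Notation X0 := ('X_idx0 : {mpoly K[n]}).
Local Notation X1 := ('X_idx1 : {mpoly K[n]}).

(** Both [elt_char2] and [elt_odd] are of this shape. *)
Definition top_left_ext (B : 'M[K]_2) : 'M[K]_n := block_mx B 0 0 (1%:M : 'M_m).

Lemma top_left_ext_ul (B : 'M[K]_2) (i j : 'I_2) :
  top_left_ext B (lshift m i) (lshift m j) = B i j.
Proof. exact: block_mxEul. Qed.

Lemma top_left_ext_ur (B : 'M[K]_2) (i : 'I_2) (j : 'I_m) :
  top_left_ext B (lshift m i) (rshift 2 j) = 0.
Proof. by rewrite [LHS]block_mxEur mxE. Qed.

Lemma top_left_ext_dl (B : 'M[K]_2) (i : 'I_m) (j : 'I_2) :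
  top_left_ext B (rshift 2 i) (lshift m j) = 0.
Proof. by rewrite [LHS]block_mxEdl mxE. Qed.

Lemma top_left_ext_col (B : 'M[K]_2) (j : 'I_2) (F : 'I_n -> {mpoly K[n]}) :
  \sum_i top_left_ext B i (lshift m j) *: F i = B 0 j *: F idx0 + B 1 j *: F idx1.
Proof.
rewrite (@big_split_ord _ _ _ 2 m) /= [X in _ + X]big1 => [|i _]; last first.
  by rewrite top_left_ext_dl scale0r.
have E : lift ord0 ord0 = 1 :> 'I_2 by apply: val_inj.
by rewrite addr0 big_ord_recl big_ord1 !E !top_left_ext_ul.
Qed.

Lemma top_left_ext_row (B : 'M[K]_2) (i : 'I_2) (F : 'I_n -> K) :
  \sum_j top_left_ext B (lshift m i) j ^+ p * F j =
  B i 0 ^+ p * F idx0 + B i 1 ^+ p * F idx1.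
Proof.
rewrite (@big_split_ord _ _ _ 2 m) /= [X in _ + X]big1 => [|j _]; last first.
  by rewrite top_left_ext_ur expr0n gtn_eqF // mul0r.
have E : lift ord0 ord0 = 1 :> 'I_2 by apply: val_inj.
by rewrite addr0 big_ord_recl big_ord1 !E !top_left_ext_ul.
Qed.

Lemma binary_mdeg a b : (a + b)%N = p -> mdeg (U_(idx0) *+ a + U_(idx1) *+ b)%MM = p.
Proof. by move=> <-; rewrite mdegD !mdegMn !mdeg1 !mul1n. Qed.

Definition binary_monomial a b (abp : (a + b)%N = p) : V := monomial K (binary_mdeg abp).

Lemma binary_monomialE a b (abp : (a + b)%N = p) :
  binary_monomial abp = X0 ^+ a * X1 ^+ b :> {mpoly K[n]}.
Proof. by rewrite /= mpolyXD !mpolyXn. Qed.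

Lemma form_action_binary B a b (abp : (a + b)%N = p) :
  form_action p (top_left_ext B) (binary_monomial abp) =
  (B 0 0 *: X0 + B 1 0 *: X1) ^+ a * (B 0 1 *: X0 + B 1 1 *: X1) ^+ b :> {mpoly K[n]}.
Proof.
rewrite form_actionE binary_monomialE rmorphM !rmorphXn /= !comp_mpolyXU -!tnth_nth.
by rewrite !tnth_mktuple !top_left_ext_col.
Qed.

Variable phi : 'End(V).
Hypothesis phiW : forall v, phi v \in W.
Hypothesis phi_id : forall w, w \in W -> phi w = w.
Hypothesis phiG : equivariant G (form_action p) (form_action p) phi.

Lemma pcoef_phi_xpow i j : pcoef i (phi (xpow K p j)) = (i == j)%:R.
Proof. by rewrite phi_id ?xpow_W // pcoef_xpow. Qed.

Lemma pcoef_phi_action (B : 'M[K]_2) (i : 'I_2) v : G (top_left_ext B) ->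
  pcoef (lshift m i) (phi (form_action p (top_left_ext B) v)) =
  B i 0 ^+ p * pcoef idx0 (phi v) + B i 1 ^+ p * pcoef idx1 (phi v).
Proof. by move=> GB; rewrite phiG // pcoef_form_action // top_left_ext_row. Qed.

(** With u = x_0^(p-1) x_1 and v = x_0^(p-2) x_1^2, the relation for u forces the
coefficient of phi(u) on x_1^p to be 1, and the one for v forces twice this
coefficient to be 0. *)
Lemma odd_obstruction : (3 <= p)%N -> ~ G (elt_odd K m).
Proof.
move=> p3 Godd; pose B : 'M[K]_2 := top_left 1 1 0 1.
have GB : G (top_left_ext B) by [].
have [B00 B01 B10 B11] : [/\ B 0 0 = 1, B 0 1 = 1, B 1 0 = 0 & B 1 1 = 1].
  by rewrite !mxE.
have p1 : (p.-1 + 1)%N = p by rewrite addn1 prednK.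
have p2 : (p.-2 + 2)%N = p by rewrite addn2; case: (p) p3 => [|[|q]].
pose u := binary_monomial p1; pose v := binary_monomial p2.
have Au : form_action p (top_left_ext B) u = u + xpow K p idx0.
  apply: val_inj; rewrite /= form_action_binary.
  (* Rewriting by [-mpolyXn] also turns each variable into its first power, which
  [expr1] undoes; the same happens in the other computations of this kind. *)
  rewrite B00 B01 B10 B11 !scale1r scale0r addr0 !mpolyXD -!mpolyXn.
  by rewrite !expr1 mulrDr addrC -exprSr prednK.
have Av : form_action p (top_left_ext B) v = v + (2%:R *: u + xpow K p idx0).
  apply: val_inj; rewrite /= form_action_binary.
  rewrite B00 B01 B10 B11 !scale1r scale0r addr0 !mpolyXD -!mpolyXn.
  have -> : p = p.-2.+2 by rewrite -addn2.
  by rewrite /= scaler_nat !expr1; apply: mul_sqr_addr.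
have := pcoef_phi_action 1 v GB; have := pcoef_phi_action 0 u GB.
rewrite -/idx0 -/idx1 Au Av B00 B01 B10 B11 !expr1n expr0n gtn_eqF // !mul1r mul0r add0r.
rewrite !(linearD, linearZ) /= !(pcoefD, pcoefZ) !pcoef_phi_xpow => /addrI <-.
rewrite addr0 -[RHS]addr0 => /addrI /eqP.
by rewrite mulf_eq0 oner_eq0 orbF -(dvdn_pcharf charK) gtnNdvd.
Qed.

(** Here b is the sum of the coefficients of phi(x_0 x_1) on x_0^2 and x_1^2, which
does not depend on a. *)
Lemma char2_obstruction (p2 : p = 2%N) : exists b : K,
  forall a, a != 1 -> G (elt_char2 m a) -> a = b * (a + 1).
Proof.
have v_deg : (1 + 1)%N = p by rewrite p2.
pose v := binary_monomial v_deg.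
exists (pcoef idx0 (phi v) + pcoef idx1 (phi v)) => a a1 Ga.
pose B := top_left a (a + 1) (a + 1) a.
have GB : G (top_left_ext B) by [].
have [B00 B01 B10 B11] : [/\ B 0 0 = a, B 0 1 = a + 1, B 1 0 = a + 1 & B 1 1 = a].
  by rewrite !mxE.
have char2 : 2%N \in [pchar K] by rewrite -p2.
have a1p : a + 1 != 0 by rewrite -[X in _ + X](oppr_pchar2 char2) subr_eq0.
have Av : form_action p (top_left_ext B) v =
    v + (a * (a + 1) *: xpow K p idx0 + a * (a + 1) *: xpow K p idx1).
  apply: val_inj; rewrite /= form_action_binary.
  rewrite B00 B01 B10 B11 !mpolyXD -!mpolyXn [in RHS]p2 -!mul_mpolyC !expr1.
  rewrite !(mpolyCM, mpolyCD) mpolyC1; apply: mul_swap_pchar2.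
  by rewrite (pchar_lalg {mpoly K[n]}).
have := pcoef_phi_action 0 v GB.
rewrite -/idx0 Av B00 B01 !(linearD, linearZ) /= !(pcoefD, pcoefZ) !pcoef_phi_xpow.
rewrite eqxx mulr1 [idx0 == idx1]/= mulr0 addr0.
move: (pcoef idx0 _) (pcoef idx1 _) => b0 b1; rewrite p2 => E.
apply: (mulIf a1p); apply: (addrI b0); rewrite E.
(* The two sides differ by twice b0 + a b0. *)
by rewrite -[LHS]addr0 -(mulrn_pchar char2 (b0 + a * b0)); ring.
Qed.

End Obstruction.

(** * The non-split extension *)

Theorem mainTheorem1 (K : closedFieldType) (p : nat) (charK : p \in [pchar K])
    (m : nat) (G : 'M[K]_(m.+2) -> Prop) (hG : closed_subgroup G)
    (ha : p = 2%N -> exists s : seq K,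
       [/\ uniq s, (3 <= size s)%N &
           forall a, a \in s -> G (elt_char2 m a)])
    (hb : (3 <= p)%N -> G (elt_odd K m)) :
  [/\ gmodule G (form_action p),
      submodule G (form_action p) (W K m p),
      gmodule G (VW_action p),
      submodule G (VW_action p) (U K m p) &
      submodule G (VW_action p) (Ut K m p)] /\
  short_exact G (sub_action (VW_action p) (U K m p))
    (sub_action (VW_action p) (Ut K m p)) (@trivial_action K m.+2)
    (U_incl K m p) (Ut_proj K m p) /\
  ~ splits G (sub_action (VW_action p) (Ut K m p)) (U_incl K m p).
Proof.
split.
  split; [exact: form_gmodule | exact: W_submodule | exact: VW_gmodule
         | exact: U_submodule | exact: Ut_submodule].
split; first exact: U_Ut_short_exact.
case/(splits_equivariant_projection hG charK) => phi [phiW phi_id phiG].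
have [p_gt2|p_le2] := ltnP 2 p.
  exact: (odd_obstruction charK phiW phi_id phiG p_gt2 (hb p_gt2)).
have p2 : p = 2%N.
  by apply/eqP; rewrite eqn_leq p_le2 (prime_gt1 (pcharf_prime charK)).
have [s [s_uniq s_size sG]] := ha p2.
have [b bP] := char2_obstruction charK phiW phi_id phiG p2.
(* Discarding the value 1 loses at most one element of s. *)
have : (1 < size [seq a <- s | (a != 1)%R])%N.
  rewrite size_filter -(leq_add2l (count (pred1 1%R) s)).
  rewrite (count_predC (pred1 1%R) s) count_uniq_mem //.
  by apply: leq_trans s_size; case: (1%R \in s).
have : {in [seq a <- s | a != 1], forall a, a = b * (a + 1)}.
  by move=> a; rewrite mem_filter => /andP[a1 /sG]; apply: bP.
have : uniq [seq a <- s | a != 1] by apply: filter_uniq.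
case: [seq _ <- _ | _] => [|x [|y t]] // xy_uniq xyP _.
have xE : x = b * (x + 1) by apply: xyP; rewrite inE eqxx.
have yE : y = b * (y + 1) by apply: xyP; rewrite !inE eqxx orbT.
have xy : x * (y + 1) = y * (x + 1) by rewrite {1}xE {2}yE; ring.
move: xy xy_uniq; rewrite !mulrDr !mulr1 [y * x]mulrC => /addrI ->.
by rewrite /= inE eqxx.
Qed.
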